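(* Let $\nu>0$, let $\boldsymbol q=(q_k)_{k\in\mathbb N}$ be a branching mechanism, and let $\Psi_{\nu,\boldsymbol q}$ be defined through its Legendre transform, i.e. $\Psi_{\nu,\boldsymbol q}(r)=\sup_{s\in\mathbb R}\{rs-\Psi^*_{\nu,\boldsymbol q}(s)\}$ with $$\Psi^*_{\nu,\boldsymbol q}(s)=\nu\sum_{k=0}^{+\infty}q_k\left\{\exp\left((k-1)\frac s\nu\right)-1\right\}.$$ Then for all $r\in\mathbb R$, $$\Psi_{\nu,\boldsymbol q}(r)=\inf\left\{\nu h(\tilde{\boldsymbol q}|\boldsymbol q)\ :\ \tilde{\boldsymbol q}\in\mathcal M_+(\mathbb N),\ \sum_k(k-1)\tilde q_k=r\right\}\in[0,+\infty].$$
   Context: $\mathbb N=\{0,1,2,\dots\}$. $\mathcal M_+(\mathbb N)$ is the set of finite nonnegative measures on $\mathbb N$, identified with summable nonnegative sequences. A branching mechanism is $\boldsymbol q\in\mathcal M_+(\mathbb N)$ with $q_1=0$ and $\sum_kkq_k<+\infty$. $h(\tilde{\boldsymbol q}|\boldsymbol q)=\sum_k\{\tilde q_k\log\frac{\tilde q_k}{q_k}+q_k-\tilde q_k\}$, with value $+\infty$ if $\tilde q_k>0=q_k$ for some $k$ (and $0\log0=0\log\frac00=0$). $\inf\emptyset=+\infty$. *)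

(* Defs.v *)
From mathcomp Require Import all_boot all_order all_algebra.
From mathcomp Require Import all_classical all_reals all_analysis.

Set Implicit Arguments.
Unset Strict Implicit.
Unset Printing Implicit Defensive.

Import Order.TTheory GRing.Theory Num.Theory.
Import numFieldNormedType.Exports.

Local Open Scope classical_set_scope.
Local Open Scope ring_scope.
Local Open Scope ereal_scope.

(* Finite nonnegative measures on nat, as summable nonnegative sequences. *)
Definition Mplus (R : realType) : set (nat -> R) :=
  [set q | (forall k, (0 <= q k)%R) /\ \sum_(0 <= k <oo) (q k)%:E < +oo].

Definition branching_mechanism (R : realType) (q : nat -> R) : Prop :=
  [/\ Mplus q, q 1%N = 0%R & \sum_(0 <= k <oo) (k%:R * q k)%:E < +oo].

(* When a = 0 the product [a * ln (a / b)] vanishes whatever the value of the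
   logarithm, which gives the conventions 0 log 0 = 0 log (0/0) = 0. *)
Definition entropy_term (R : realType) (a b : R) : \bar R :=
  if (0 < a)%R && (b == 0%R) then +oo else (a * ln (a / b) + b - a)%:E.

Definition relative_entropy (R : realType) (p q : nat -> R) : \bar R :=
  \sum_(0 <= k <oo) entropy_term (p k) (q k).

(* The series is taken in the extended reals; for q in [Mplus] its limit
   exists in ]-oo, +oo]: the positive parts of the terms may fail to be
   summable, but the negative parts never do. *)
Definition Psi_star (R : realType) (nu : R) (q : nat -> R) (s : R) : \bar R :=
  nu%:E *
  \sum_(0 <= k <oo) (q k * (expR ((k%:R - 1) * (s / nu)) - 1))%:E.

Definition Psi (R : realType) (nu : R) (q : nat -> R) (r : R) : \bar R :=
  ereal_sup [set (r * s)%:E - Psi_star nu q s | s in [set: R]].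

(* Main.v *)
Require Import Defs.
From mathcomp Require Import all_boot all_order all_algebra.
From mathcomp Require Import all_classical all_reals all_analysis.
From mathcomp Require Import ring lra.

Set Implicit Arguments.
Unset Strict Implicit.
Unset Printing Implicit Defensive.

Import Order.TTheory GRing.Theory Num.Theory.
Import numFieldNormedType.Exports.

Local Open Scope classical_set_scope.
Local Open Scope ring_scope.
Local Open Scope ereal_scope.

(** This is Fenchel-Rockafellar duality for the relative entropy under one linear
    constraint. Write M(t) for the exponential moment sum_k q_k exp ((k - 1) t)
    and Q for the mass of q; then Psi_star (nu t) = nu (M(t) - Q), and the dual
    value is nu sup_t (r t - M(t) + Q).

    The dual value is at most the primal one (Psi_le_entropy) by Young's
    inequality, summed against an admissible p.

    For the converse, a dual optimiser t should give the primal optimiser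
    p_k = q_k exp ((k - 1) t). That may fail for want of exponential moments: M can
    jump to +oo and the primal infimum need not be attained, since mass can
    escape to infinity at vanishing cost. So the tilt is cut off at n. Solving the
    truncated drift equation sum_(k < n) (k - 1) q_k exp ((k - 1) t_n) = r by the
    intermediate value theorem yields admissible measures of entropy at most
    r t_n - M_n(t_n) + Q (min_entropy_le_tilt). The t_n stay in a compact interval,
    and since M_n increases to M, a cluster point of t_n is a dual point whose value
    is at least the primal infimum (min_entropy_le_Psi_bracket).

    A compact interval of this kind exists unless q charges no k > 1 and r >= 0,
    or q charges no k < 1 and r <= 0. Then either the dual value is +oo,
    or r = 0, p = 0 is admissible and the dual objective tends to its cost nu Q
    along a half-line (min_entropy_le_Psi_onesided). *)

(** * Series of extended reals *)

Lemma nneseries_le_partial (R : realType) (f : nat -> \bar R) (x : \bar R) :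
  (forall k, 0 <= f k) -> (forall n, \sum_(0 <= k < n) f k <= x) ->
  \sum_(0 <= k <oo) f k <= x.
Proof.
move=> f0 fx; apply: lime_le; last by apply: nearW => n; exact: fx.
exact: is_cvg_nneseries.
Qed.

(** Both signed series of the problem, the drift of p and the exponent Psi_star,
    are differences of nonnegative series of which the second has a finite sum;
    this is what excludes oo - oo and lets partial sums pass to the limit. *)
Lemma cvg_nneseriesB (R : realType) (u v : nat -> R) :
  (forall k, (0 <= u k)%R) -> (forall k, (0 <= v k)%R) ->
  \sum_(0 <= k <oo) (v k)%:E < +oo ->
  (fun n => \sum_(0 <= k < n) (u k - v k)%:E) @ \oo -->
    \sum_(0 <= k <oo) (u k)%:E - \sum_(0 <= k <oo) (v k)%:E.
Proof.
move=> u0 v0 vfin.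
have u0' k : 0 <= (u k)%:E by rewrite lee_fin.
have v0' k : 0 <= (v k)%:E by rewrite lee_fin.
have vf : \sum_(0 <= k <oo) (v k)%:E \is a fin_num.
  by rewrite ge0_fin_numE//; exact: nneseries_ge0.
under eq_fun => n do rewrite sumEFin sumrB EFinB -!sumEFin.
apply: cvgeB; first by rewrite fin_num_adde_defl// fin_numN.
- by apply: is_cvg_nneseries => n _ _.
- by apply: is_cvg_nneseries => n _ _.
Qed.

(** * The dual problem *)

Definition exp_moment (R : realType) (q : nat -> R) (t : R) : \bar R :=
  \sum_(0 <= k <oo) (q k * expR ((k%:R - 1) * t))%:E.

Lemma Mplus_massE (R : realType) (q : nat -> R) : Mplus q ->
  \sum_(0 <= k <oo) (q k)%:E = (fine (\sum_(0 <= k <oo) (q k)%:E))%:E.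
Proof.
move=> [q0 qfin]; rewrite fineK// ge0_fin_numE//.
by apply: nneseries_ge0 => k _ _; rewrite lee_fin.
Qed.

Lemma exp_moment_ge0 (R : realType) (q : nat -> R) (t : R) : Mplus q ->
  0 <= exp_moment q t.
Proof.
by move=> [q0 _]; apply: nneseries_ge0 => k _ _; rewrite lee_fin mulr_ge0 ?expR_ge0.
Qed.

Lemma Psi_starE (R : realType) (nu : R) (q : nat -> R) (Q s : R) : Mplus q ->
  \sum_(0 <= k <oo) (q k)%:E = Q%:E ->
  Psi_star nu q s = nu%:E * (exp_moment q (s / nu) - Q%:E).
Proof.
move=> [q0 qfin] qQ; rewrite /Psi_star; congr (_ * _).
rewrite -qQ; apply/cvg_lim => //.
under eq_fun => n do under eq_bigr => k _ do rewrite mulrBr mulr1.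
by apply: cvg_nneseriesB => // k; rewrite mulr_ge0 ?expR_ge0.
Qed.

(** Evaluation at s = nu t. Bounding the exponential moment by a real c allows
    for infinite moments elsewhere and keeps the bound a real number. *)
Lemma Psi_ge (R : realType) (nu : R) (q : nat -> R) (Q r t c : R) :
  (0 < nu)%R -> Mplus q -> \sum_(0 <= k <oo) (q k)%:E = Q%:E ->
  exp_moment q t <= c%:E -> (nu * (r * t - c + Q))%:E <= Psi nu q r.
Proof.
move=> nu0 qM qQ Mc.
have -> : (nu * (r * t - c + Q))%:E = (r * (nu * t))%:E - nu%:E * (c%:E - Q%:E).
  by rewrite -[(c%:E - Q%:E)]EFinB -EFinM -EFinB; congr _%:E; ring.
apply: le_trans (ereal_sup_ubound _); last by exists (nu * t)%R.
rewrite (Psi_starE _ _ qM qQ) [(nu * t)%R]mulrC mulfK ?gt_eqF//.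
by rewrite leeB// lee_pmul2l// leeB.
Qed.

(** * Weak duality *)

(** Young's inequality for the conjugate pair a log (a / b) + b - a and
    b (exp y - 1). With a = b exp x it is 1 + (y - x) <= exp (y - x) multiplied
    by a. *)
Lemma entropy_young (R : realType) (a b y : R) : (0 <= a)%R -> (0 <= b)%R ->
  (a * y + b)%:E <= entropy_term a b + (b * expR y)%:E.
Proof.
move=> a0 b0; rewrite /entropy_term; case: ifPn => [_|ab].
  by rewrite addye// leey.
rewrite -EFinD lee_fin.
have [->|an0] := eqVneq a 0%R.
  by rewrite !mul0r !add0r subr0 lerDl mulr_ge0 ?expR_ge0.
have ap : (0 < a)%R by rewrite lt_neqAle eq_sym an0.
have bp : (0 < b)%R by move: ab; rewrite ap/= lt_neqAle eq_sym b0 => ->.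
set x := ln (a / b).
have -> : (b * expR y = a * expR (y - x))%R.
  rewrite expRB /x lnK ?posrE ?divr_gt0//; field.
  by rewrite !gt_eqF.
have := ler_wpM2l a0 (expR_ge1Dx (y - x)); lra.
Qed.

Lemma entropy_term_ge0 (R : realType) (a b : R) : (0 <= a)%R -> (0 <= b)%R ->
  0 <= entropy_term a b.
Proof.
move=> a0 b0; have := entropy_young 0 a0 b0.
by rewrite mulr0 add0r expR0 mulr1 -leeBlDr// subee.
Qed.

(** Summing Young's inequality with y = (k - 1) t gives
    t r + Q <= h(p|q) + M(t), where M is the exponential moment. The summation is
    made on partial sums: their left side converges because the drift of p does,
    whatever the sign of t, and their right side is bounded by the two
    nonnegative series. *)
Lemma Psi_le_entropy (R : realType) (nu : R) (p q : nat -> R) (r : R) :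
  (0 < nu)%R -> Mplus q -> Mplus p ->
  \sum_(0 <= k <oo) ((k%:R - 1) * p k)%:E = r%:E ->
  Psi nu q r <= nu%:E * relative_entropy p q.
Proof.
move=> nu0 qM pM pr.
have qQ := Mplus_massE qM; set Q := fine _ in qQ.
have [[q0 _] [p0 pfin]] := (qM, pM).
have e0 k : 0 <= entropy_term (p k) (q k) by exact: entropy_term_ge0.
have drift_cvg : (fun n => \sum_(0 <= k < n) ((k%:R - 1) * p k)%:E) @ \oo --> r%:E.
  have : (fun n => \sum_(0 <= k < n) ((k%:R - 1) * p k)%:E) @ \oo -->
      \sum_(0 <= k <oo) (k%:R * p k)%:E - \sum_(0 <= k <oo) (p k)%:E.
    under eq_fun => n do under eq_bigr => k _ do rewrite mulrBl mul1r.
    by apply: cvg_nneseriesB => // k; rewrite mulr_ge0.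
  by move=> cv; rewrite -pr (cvg_lim _ cv).
apply: ge_ereal_sup => _ [s _ <-].
rewrite (Psi_starE _ _ qM qQ); set t := (s / nu)%R.
have -> : s = (nu * t)%R by rewrite /t mulrC divfK ?gt_eqF.
(* An infinite moment makes the dual objective -oo. *)
have [->|Mfin] := eqVneq (exp_moment q t) +oo.
  by rewrite addye// gt0_muley// addeNy leNye.
have Mf : exp_moment q t \is a fin_num.
  by rewrite ge0_fin_numE ?exp_moment_ge0// ltey.
rewrite -(fineK Mf); set m := fine _.
have -> : (r * (nu * t))%:E - nu%:E * (m%:E - Q%:E) = nu%:E * (t * r + Q - m)%:E.
  by rewrite -[(m%:E - Q%:E)]EFinB -!EFinM -EFinB; congr _%:E; ring.
rewrite lee_pmul2l// EFinB leeBlDr// /m fineK//.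
have cv : (fun n => \sum_(0 <= k < n) (t * ((k%:R - 1) * p k) + q k)%:E) @ \oo -->
    (t * r + Q)%:E.
  under eq_fun => n.
    rewrite sumEFin big_split/= -mulr_sumr EFinD EFinM -!sumEFin.
  over.
  rewrite EFinD EFinM; apply: cvgeD => //; first exact: cvgeZl.
  by rewrite -qQ; apply: is_cvg_nneseries => k _ _; rewrite lee_fin.
apply: cvge_le cv; apply: nearW => n.
apply: (@le_trans _ _ (\sum_(0 <= k < n)
    (entropy_term (p k) (q k) + (q k * expR ((k%:R - 1) * t))%:E))).
  apply: lee_sum => k _; apply: le_trans (entropy_young _ (p0 k) (q0 k)).
  by rewrite lee_fin lerD2r; rewrite le_eqVlt; apply/orP; left; apply/eqP; ring.
rewrite big_split/=; apply: leeD; apply: nneseries_lim_ge => k _ _ //.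
by rewrite lee_fin mulr_ge0 ?expR_ge0.
Qed.

(** * Truncated exponential tilts *)

Definition trunc_moment (R : realType) (q : nat -> R) (n : nat) (t : R) : R :=
  (\sum_(0 <= k < n) q k * expR ((k%:R - 1) * t))%R.

Definition trunc_drift (R : realType) (q : nat -> R) (n : nat) (t : R) : R :=
  (\sum_(0 <= k < n) (k%:R - 1) * (q k * expR ((k%:R - 1) * t)))%R.

(** The optimality condition of the dual problem selects the density
    exp ((k - 1) t) with respect to q. Cutting it off at n keeps every sum
    finite although q may have no exponential moment. *)
Definition tilt (R : realType) (q : nat -> R) (n : nat) (t : R) (k : nat) : R :=
  if (k < n)%N then (q k * expR ((k%:R - 1) * t))%R else 0%R.

(** Weighted sums against a tilt are stationary from n on; the weight c covers
    both the mass (c = 1) and the drift (c k = k - 1). *)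
Lemma sum_tilt (R : realType) (q c : nat -> R) (n : nat) (t : R) (N : nat) :
  (n <= N)%N ->
  (\sum_(0 <= k < N) c k * tilt q n t k =
   \sum_(0 <= k < n) c k * (q k * expR ((k%:R - 1) * t)))%R.
Proof.
move=> nN; rewrite (big_cat_nat (leq0n n) nN)/= [X in (_ + X)%R]big_nat.
have -> : (\sum_(n <= k < N | (n <= k < N)%N) c k * tilt q n t k = 0)%R.
  by apply: big1 => k /andP[nk _]; rewrite /tilt ltnNge nk mulr0.
by rewrite addr0; apply: eq_big_nat => k /andP[_ kn]; rewrite /tilt kn.
Qed.

Lemma eseries_tilt (R : realType) (q c : nat -> R) (n : nat) (t : R) :
  \sum_(0 <= k <oo) (c k * tilt q n t k)%:E =
  (\sum_(0 <= k < n) c k * (q k * expR ((k%:R - 1) * t)))%:E.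
Proof.
apply: lim_near_cst => //; exists n => // N/= nN.
by rewrite sumEFin sum_tilt.
Qed.

(** For p = q exp ((k - 1) t) the entropy integrand is affine in p, namely
    t (k - 1) p - p + q, so the entropy is read off from the drift and the mass
    of p. Past the cutoff p = 0 costs q there, so the whole mass Q is paid. *)
Lemma entropy_tilt (R : realType) (q : nat -> R) (Q : R) (n : nat) (t : R) :
  Mplus q -> \sum_(0 <= k <oo) (q k)%:E = Q%:E ->
  relative_entropy (tilt q n t) q <=
  (t * trunc_drift q n t - trunc_moment q n t + Q)%:E.
Proof.
move=> [q0 _] qQ.
have p0 k : (0 <= tilt q n t k)%R.
  by rewrite /tilt; case: ifP => // _; rewrite mulr_ge0 ?expR_ge0.
have eE k : entropy_term (tilt q n t k) (q k) =
    (t * ((k%:R - 1) * tilt q n t k) - 1 * tilt q n t k + q k)%:E.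
  rewrite /entropy_term /tilt; case: (ltnP k n) => _; last first.
    by rewrite ltxx/=; congr _%:E; ring.
  have [->|qn0] := eqVneq (q k) 0%R.
    by rewrite mul0r ltxx/=; congr _%:E; ring.
  rewrite andbF [X in ln (X / _)]mulrC mulfK// expRK; congr _%:E; ring.
have e0 k : 0 <= entropy_term (tilt q n t k) (q k) by exact: entropy_term_ge0.
apply: nneseries_le_partial => // N.
(* Beyond the cutoff n the partial sums of the affine form are explicit. *)
apply: (@le_trans _ _ (\sum_(0 <= k < maxn n N) entropy_term (tilt q n t k) (q k))).
  rewrite [leRHS](big_cat_nat (leq0n N) (leq_maxr n N))/= leeDl//.
  by apply: sume_ge0.
under eq_bigr do rewrite eE.
rewrite sumEFin big_split/= sumrB -mulr_sumr !sum_tilt ?leq_maxl//.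
under [X in (_ - X)%R]eq_bigr do rewrite mul1r.
rewrite !EFinD leeD2l// -qQ -sumEFin.
by apply: nneseries_lim_ge => k _ _; rewrite lee_fin.
Qed.

Definition min_entropy (R : realType) (nu : R) (q : nat -> R) (r : R) : \bar R :=
  ereal_inf [set nu%:E * relative_entropy p q | p in
    [set p : nat -> R | Mplus p /\
      \sum_(0 <= k <oo) ((k%:R - 1) * p k)%:E = r%:E]].

Lemma min_entropy_le_tilt (R : realType) (nu : R) (q : nat -> R) (Q r : R)
    (n : nat) (t : R) :
  (0 < nu)%R -> Mplus q -> \sum_(0 <= k <oo) (q k)%:E = Q%:E ->
  trunc_drift q n t = r ->
  min_entropy nu q r <= (nu * (r * t - trunc_moment q n t + Q))%:E.
Proof.
move=> nu0 qM qQ gr.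
apply: (@le_trans _ _ (nu%:E * relative_entropy (tilt q n t) q)).
  apply: ereal_inf_lbound; exists (tilt q n t) => //; split; first split.
  - move=> k; rewrite /tilt; case: ifP => // _.
    by rewrite mulr_ge0 ?expR_ge0//; case: qM.
  - under eq_eseriesr do rewrite -[tilt _ _ _ _]mul1r.
    by rewrite (eseries_tilt q (fun=> 1%R)) ltry.
  - by rewrite (eseries_tilt q (fun k => k%:R - 1)%R) -gr.
rewrite EFinM lee_pmul2l//; apply: le_trans (entropy_tilt _ _ qM qQ) _.
by rewrite gr mulrC.
Qed.

(** * Strong duality when the drift equation is solvable *)

Lemma continuous_trunc_moment (R : realType) (q : nat -> R) (n : nat) :
  continuous (trunc_moment q n).
Proof.
apply: continuous_big => [|k _ t]; first exact: add_continuous.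
apply: cvgMl_tmp.
apply: continuous_comp; last exact: continuous_expR.
exact: mulrl_continuous.
Qed.

Lemma continuous_trunc_drift (R : realType) (q : nat -> R) (n : nat) :
  continuous (trunc_drift q n).
Proof.
apply: continuous_big => [|k _ t]; first exact: add_continuous.
apply: cvgMl_tmp; apply: cvgMl_tmp.
apply: continuous_comp; last exact: continuous_expR.
exact: mulrl_continuous.
Qed.

Lemma trunc_moment_nd (R : realType) (q : nat -> R) (m n : nat) (t : R) :
  (forall k, (0 <= q k)%R) -> (m <= n)%N ->
  (trunc_moment q m t <= trunc_moment q n t)%R.
Proof.
move=> q0 mn; rewrite /trunc_moment [leRHS](big_cat_nat (leq0n m) mn)/= lerDl.
by apply: sumr_ge0 => k _; rewrite mulr_ge0 ?expR_ge0.
Qed.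

(** If [a, b] brackets the solutions of the truncated drift equations uniformly
    in n, solve each of them by t_n in [a, b]. The truncated tilts bound the
    primal value by nu (r t_n - M_n(t_n) + Q), with M_n increasing in n. Hence the
    closed set where r s - M_m(s) + Q is at least the primal value over nu
    contains t_n as soon as n >= m, so it contains every cluster point c of t_n.
    As m is arbitrary, the untruncated M(c) is finite and c is a dual point that
    is at least as good as the primal value. *)
Lemma min_entropy_le_Psi_bracket (R : realType) (nu : R) (q : nat -> R)
    (r a b : R) (N : nat) :
  (0 < nu)%R -> Mplus q -> (a <= b)%R ->
  (forall n, (N <= n)%N -> (trunc_drift q n a <= r <= trunc_drift q n b)%R) ->
  min_entropy nu q r <= Psi nu q r.
Proof.
move=> nu0 qM ab brk; have qQ := Mplus_massE qM; set Q := fine _ in qQ.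
have q0 : forall k, (0 <= q k)%R by case: qM.
have tP n : exists t, t \in `[a, b] /\ trunc_drift q (N + n) t = r.
  have /andP[ga gb] := brk _ (leq_addr n N).
  have [||t tab tr] := @IVT R (trunc_drift q (N + n)) a b r ab.
  - by apply: continuous_subspaceT; exact: continuous_trunc_drift.
  - by rewrite ge_min le_max ga gb orbT.
  - by exists t.
have {tP}[t tP] := choice tP.
have le_tilt n := min_entropy_le_tilt nu0 qM qQ (tP n).2.
case Ev : (min_entropy nu q r) le_tilt => [v| |] le_tilt; last exact: leNye.
  2: by have := le_tilt 0%N; rewrite leye_eq.
have moment_t n : (trunc_moment q (N + n) (t n) <= r * t n - v / nu + Q)%R.
  have := le_tilt n; rewrite lee_fin mulrC -ler_pdivrMr//; lra.
have [c [cab cl]] : `[a, b]%classic `&` cluster (t @ \oo) !=set0.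
  apply: segment_compact; exists 0%N => // n _ /=.
  exact: (tP n).1.
have moment_c m : (trunc_moment q m c <= r * c - v / nu + Q)%R.
  pose f s := (r * s - v / nu + Q - trunc_moment q m s)%R.
  have fcont : continuous f.
    move=> s; apply: cvgB; last exact: continuous_trunc_moment.
    apply: cvgD; last exact: cvg_cst.
    apply: cvgB; last exact: cvg_cst.
    exact: mulrl_continuous.
  suff : (0 <= f c)%R by rewrite /f subr_ge0.
  have fcl : closed (f @^-1` [set x | (0 <= x)%R]).
    by apply: preimage_closed => [s _|]; [exact: fcont|exact: closed_ge].
  apply: fcl; move: cl; rewrite clusterE => /(_ (f @^-1` [set x | 0 <= x]%R)); apply.
  exists m => // n /= mn; rewrite /f subr_ge0.
  apply: le_trans (moment_t n); apply: trunc_moment_nd => //.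
  by rewrite (leq_trans mn)// leq_addl.
have := @Psi_ge R nu q Q r c (r * c - v / nu + Q)%R nu0 qM qQ.
have -> : (nu * (r * c - (r * c - v / nu + Q) + Q) = v)%R.
  by field; rewrite gt_eqF.
apply; apply: nneseries_le_partial => [k|n].
  by rewrite lee_fin mulr_ge0 ?expR_ge0.
by rewrite sumEFin lee_fin; exact: moment_c.
Qed.

(** Either exp b outgrows r, or - x exp (- b) rises above a negative r; both follow
    from exp b >= 1 + b. Both ends of the bracket come from this estimate: the
    left end a = - b is obtained for - r, with the roles of x and w exchanged. *)
Lemma exp_escape (R : realType) (x w r : R) :
  (0 <= x)%R -> (0 <= w)%R -> (0 < w)%R \/ (r < 0)%R ->
  exists2 b, (0 <= b)%R & (r <= w * expR b - x * expR (- b))%R.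
Proof.
move=> x0 w0 [wp|rn].
  exists ((`|r| + x) / w)%R; first by rewrite divr_ge0// addr_ge0.
  set b := (_ / _)%R.
  have b0 : (0 <= b)%R by rewrite divr_ge0// addr_ge0.
  have wb : (w * b = `|r| + x)%R by rewrite /b mulrC divfK// gt_eqF.
  have h1 := ler_wpM2l w0 (expR_ge1Dx b).
  have h2 : (x * expR (- b) <= x * 1)%R.
    by apply: ler_wpM2l => //; rewrite -expR0 ler_expR oppr_le0.
  have := ler_norm r; lra.
exists (x / - r)%R; first by rewrite divr_ge0// oppr_ge0 ltW.
set b := (_ / _)%R.
have rb : (- r * b = x)%R by rewrite /b mulrC divfK// oppr_eq0 lt_eqF.
have h1 : (x * expR (- b) <= - r)%R.
  rewrite expRN ler_pdivrMr ?expR_gt0//.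
  have := @ler_wpM2l _ (- r)%R _ _ _ (expR_ge1Dx b).
  by rewrite oppr_ge0 ltW// => /(_ isT); lra.
have : (0 <= w * expR b)%R by rewrite mulr_ge0 ?expR_ge0.
lra.
Qed.

(** Comparing every exp (k t), k >= 1, with exp t bounds the truncated drift by a
    combination of exp t and exp (- t); this is the coefficient of exp t. The
    index is shifted by one, so that k stands for the jump size. *)
Definition trunc_slope (R : realType) (q : nat -> R) (n : nat) : R :=
  (\sum_(0 <= k < n) k%:R * q k.+1)%R.

Lemma trunc_drift_recl (R : realType) (q : nat -> R) (n : nat) (t : R) :
  trunc_drift q n.+1 t =
  (\sum_(0 <= k < n) k%:R * q k.+1 * expR (k%:R * t) - q 0%N * expR (- t))%R.
Proof.
rewrite /trunc_drift big_nat_recl//= addrC; congr (_ + _)%R.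
  by apply: eq_bigr => k _; rewrite -natr1 addrK mulrA.
by rewrite sub0r !mulN1r.
Qed.

Lemma trunc_drift_le (R : realType) (q : nat -> R) (n : nat) (t : R) :
  (forall k, (0 <= q k)%R) -> (t <= 0)%R ->
  (trunc_drift q n.+1 t <= trunc_slope q n * expR t - q 0%N * expR (- t))%R.
Proof.
move=> q0 t0; rewrite trunc_drift_recl lerD2r mulr_suml.
apply: ler_sum => -[|k] _; first by rewrite !mul0r.
by rewrite ler_wpM2l ?mulr_ge0// ler_expR ler_neMl// ler1n.
Qed.

Lemma trunc_drift_ge (R : realType) (q : nat -> R) (n : nat) (t : R) :
  (forall k, (0 <= q k)%R) -> (0 <= t)%R ->
  (trunc_slope q n * expR t - q 0%N * expR (- t) <= trunc_drift q n.+1 t)%R.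
Proof.
move=> q0 t0; rewrite trunc_drift_recl lerD2r mulr_suml.
apply: ler_sum => -[|k] _; first by rewrite !mul0r.
by rewrite ler_wpM2l ?mulr_ge0// ler_expR ler_peMl// ler1n.
Qed.

(** * Strong duality in the degenerate cases *)

(** When q charges at most one side of 1, the moment along the direction sigma is
    at most Q exp (- t), so that the dual objective is at least
    nu (r sigma t + Q - Q exp (- t)) for all t >= 0. It is unbounded if
    r sigma > 0. If r = 0 it tends to nu Q, which is the cost of the admissible
    measure p = 0; the supremum need not be attained, which is why this case
    is not reached through the drift equation. *)
Lemma min_entropy_le_Psi_onesided (R : realType) (nu : R) (q : nat -> R)
    (r sigma : R) :
  (0 < nu)%R -> Mplus q -> (sigma != 0)%R -> (0 <= r * sigma)%R ->
  (forall k, q k != 0%R -> ((k%:R - 1) * sigma <= -1)%R) ->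
  min_entropy nu q r <= Psi nu q r.
Proof.
move=> nu0 qM s0 rs0 supp; have qQ := Mplus_massE qM; set Q := fine _ in qQ.
have q0 : forall k, (0 <= q k)%R by case: qM.
have Q0 : (0 <= Q)%R.
  by rewrite -lee_fin -qQ; apply: nneseries_ge0 => k _ _; rewrite lee_fin.
have low t : (0 <= t)%R ->
    (nu * (r * sigma * t - expR (- t) * Q + Q))%:E <= Psi nu q r.
  move=> t0; rewrite -mulrA; apply: Psi_ge => //.
  rewrite EFinM -qQ -nneseriesZl; last by move=> k _; rewrite lee_fin.
  apply: lee_nneseries => [k _ _|k _]; first by rewrite lee_fin mulr_ge0 ?expR_ge0.
  rewrite -EFinM lee_fin mulrC.
  have [->|qk] := eqVneq (q k) 0%R; first by rewrite !mulr0.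
  rewrite ler_wpM2r// ler_expR mulrA.
  by have := ler_wpM2r t0 (supp _ qk); rewrite mulN1r.
move: rs0; rewrite le_eqVlt => /orP[/eqP rs0|rsp].
  have r0 : r = 0%R by move/esym/eqP: rs0; rewrite mulf_eq0 (negbTE s0) orbF => /eqP.
  (* The tilt cut off at 0 is the null measure. *)
  have := @min_entropy_le_tilt R nu q Q r 0 0 nu0 qM qQ.
  rewrite /trunc_drift /trunc_moment !big_nil r0 mul0r subrr add0r => /(_ erefl).
  move=> h; apply: le_trans h _; apply/lee_addgt0Pr => e e0.
  (* exp t >= 1 + t makes nu Q exp (- t) at most e. *)
  set t := (nu * Q / e)%R.
  have t0 : (0 <= t)%R by rewrite divr_ge0 ?mulr_ge0// ltW.
  have := low _ t0; rewrite r0 !mul0r sub0r => h.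
  apply: le_trans (leeD2r e%:E h); rewrite -EFinD lee_fin.
  have et : (e * t = nu * Q)%R by rewrite /t mulrC divfK// gt_eqF.
  have : (nu * Q * expR (- t) <= e)%R.
    rewrite expRN ler_pdivrMr ?expR_gt0//.
    have := ler_wpM2l (ltW e0) (expR_ge1Dx t); lra.
  lra.
suff -> : Psi nu q r = +oo by exact: leey.
apply/eqyP => A A0.
have d0 : (0 < nu * (r * sigma))%R by rewrite mulr_gt0.
set t := (A / (nu * (r * sigma)))%R.
have t0 : (0 <= t)%R by rewrite divr_ge0// ltW.
apply: le_trans (low _ t0); rewrite lee_fin.
have -> : A = (nu * (r * sigma * t))%R by rewrite mulrA /t mulrC divfK// gt_eqF.
rewrite ler_pM2l// -addrA lerDl addrC subr_ge0 ler_piMl//.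
by rewrite -expR0 ler_expR oppr_le0.
Qed.

(** * The duality theorem *)

(** The drift equation can be bracketed from above if q charges some k >= 2 or
    r < 0, and from below if q charges 0 or r > 0; if one of these fails, q
    charges at most one side of 1 and r has the sign of the degenerate case. The first
    moment of q bounds the slopes uniformly in n, which makes the left end of the
    bracket independent of n; q 1 = 0 is what puts the degenerate support
    strictly on one side of 1. *)
Lemma min_entropy_le_Psi (R : realType) (nu : R) (q : nat -> R) (r : R) :
  (0 < nu)%R -> branching_mechanism q -> min_entropy nu q r <= Psi nu q r.
Proof.
move=> nu0 [qM q1 qmean].
have q0 : forall k, (0 <= q k)%R by case: qM.
have m0 k : 0 <= (k%:R * q k)%:E by rewrite lee_fin mulr_ge0.
set m := \sum_(0 <= k <oo) (k%:R * q k)%:E in qmean.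
have mf : m \is a fin_num by rewrite ge0_fin_numE//; exact: nneseries_ge0.
have w0 n : (0 <= trunc_slope q n)%R by apply: sumr_ge0 => k _; rewrite mulr_ge0.
have wm n : (trunc_slope q n <= fine m)%R.
  rewrite -lee_fin fineK//.
  apply: le_trans (@nneseries_lim_ge R _ xpredT 0 n.+1 _); last by [].
  rewrite sumEFin lee_fin big_nat_recl//= mul0r add0r.
  by apply: ler_sum => k _; rewrite ler_wpM2r// ler_nat.
have up : (exists k, (0 < q k.+2)%R) \/ (r < 0)%R ->
    exists2 b, (0 <= b)%R & exists N, forall n, (N <= n)%N ->
      (r <= trunc_drift q n b)%R.
  move=> H; have [N wN] : exists N, (0 < trunc_slope q N)%R \/ (r < 0)%R.
    case: H => [[k qk]|rn]; last by exists 0%N; right.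
    exists k.+2; left; rewrite /trunc_slope big_nat_recr//=.
    rewrite ltr_wpDl ?mulr_gt0// ?ltr0n//.
    by apply: sumr_ge0 => i _; rewrite mulr_ge0.
  have [b b0 rb] := exp_escape (q0 0%N) (w0 N) wN.
  exists b => //; exists N.+1 => -[//|n] Nn; apply: le_trans rb _.
  apply: le_trans (trunc_drift_ge n q0 b0); rewrite lerD2r ler_wpM2r ?expR_ge0//.
  rewrite /trunc_slope [leRHS](big_cat_nat (leq0n N))//= lerDl.
  by apply: sumr_ge0 => i _; rewrite mulr_ge0.
have down : (0 < q 0%N)%R \/ (0 < r)%R ->
    exists2 a, (a <= 0)%R & forall n, (1 <= n)%N -> (trunc_drift q n a <= r)%R.
  move=> H; have [|||b b0 rb] := @exp_escape R (fine m) (q 0%N) (- r).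
  - exact: le_trans (wm 0%N).
  - exact: q0.
  - by rewrite oppr_lt0.
  exists (- b)%R; first by rewrite oppr_le0.
  move=> [//|n] _; apply: le_trans (trunc_drift_le _ q0 _) _; first by rewrite oppr_le0.
  rewrite opprK; have := ler_wpM2r (expR_ge0 (- b)) (wm n); lra.
have [hup|nup] := pselect ((exists k, (0 < q k.+2)%R) \/ (r < 0)%R); last first.
  apply: (@min_entropy_le_Psi_onesided _ _ _ _ 1%R) => //.
    by rewrite mulr1 leNgt; apply/negP => rn; apply: nup; right.
  move=> [|[|k]]; rewrite mulr1.
  - by rewrite sub0r.
  - by rewrite q1 eqxx.
  - by move=> qk; case: nup; left; exists k; rewrite lt_neqAle eq_sym qk q0.
have [hdn|ndn] := pselect ((0 < q 0%N)%R \/ (0 < r)%R); last first.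
  apply: (@min_entropy_le_Psi_onesided _ _ _ _ (-1)%R) => //.
    by rewrite mulrN1 oppr_ge0 leNgt; apply/negP => rn; apply: ndn; right.
  move=> [|[|k]]; rewrite mulrN1.
  - by move=> qk; case: ndn; left; rewrite lt_neqAle eq_sym qk q0.
  - by rewrite q1 eqxx.
  - by move=> _; rewrite lerN2 -natr1 addrK ler1n.
have [b b0 [N bN]] := up hup; have [a a0 aN] := down hdn.
apply: (@min_entropy_le_Psi_bracket _ _ _ _ a b N.+1) => //.
  exact: le_trans b0.
by move=> n Nn; rewrite aN ?bN// ?(ltnW Nn)// (leq_trans _ Nn).
Qed.

Theorem lemma5p3 (R : realType) (nu : R) (q : nat -> R)
    (nu_gt0 : (0 < nu)%R) (q_branching : branching_mechanism q) (r : R) :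
  Psi nu q r =
    ereal_inf [set nu%:E * relative_entropy p q | p in
      [set p : nat -> R | Mplus p /\
        \sum_(0 <= k <oo) ((k%:R - 1) * p k)%:E = r%:E]]
  /\ 0 <= Psi nu q r.
Proof.
have qM : Mplus q by case: q_branching.
split.
  apply/eqP; rewrite eq_le; apply/andP; split.
    by apply: le_ereal_inf_tmp => _ [p [pM pr] <-]; exact: Psi_le_entropy.
  exact: min_entropy_le_Psi.
(* At s = 0 the dual objective vanishes. *)
have := @Psi_ge R nu q _ r 0 _ nu_gt0 qM (Mplus_massE qM).
move=> /(_ (fine (\sum_(0 <= k <oo) (q k)%:E))).
rewrite mulr0 sub0r addNr mulr0; apply.
rewrite -Mplus_massE// /exp_moment.
by under eq_eseriesr do rewrite mulr0 expR0 mulr1.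
Qed.
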